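(* Let $(H,\alpha,m,\eta,\Delta,\varepsilon)$ be a monoidal Hom-bialgebra over $k$ and let $\sigma\in H\otimes H$ be a Drinfeld twist for $H$ with inverse $\varrho=\sigma^{-1}$. Define $\Delta^\sigma:H\to H\otimes H$ by $\Delta^\sigma(x)=(\sigma\Delta(x))\varrho$ for $x\in H$. Then $H^\sigma=(H,\alpha,m,\eta,\Delta^\sigma,\varepsilon)$ is a Hom-bialgebra.
   Context: Throughout, $k$ is a commutative ring of characteristic $0$, $\otimes=\otimes_k$, and $\Delta(c)=c_1\otimes c_2$ is Sweedler notation (sums suppressed). Monoidal Hom-algebra: a $k$-module $A$ with a linear automorphism $\alpha$, a linear multiplication $m(a\otimes b)=ab$ and an element $1_A=\eta(1_k)$ such that $\alpha(ab)=\alpha(a)\alpha(b)$, $\alpha(a)(bc)=(ab)\alpha(c)$, $\alpha(1_A)=1_A$, $1_Aa=a1_A=\alpha(a)$. Monoidal Hom-coalgebra: a $k$-module $C$ with a linear automorphism $\gamma$ and linear maps $\Delta:C\to C\otimes C$, $\varepsilon:C\to k$ such that $\Delta(\gamma(c))=\gamma(c_1)\otimes\gamma(c_2)$, $\gamma^{-1}(c_1)\otimes\Delta(c_2)=\Delta(c_1)\otimes\gamma^{-1}(c_2)$, $\varepsilon\circ\gamma=\varepsilon$, $\varepsilon(c_1)c_2=c_1\varepsilon(c_2)=\gamma^{-1}(c)$. Monoidal Hom-bialgebra: $(H,\alpha,m,\eta,\Delta,\varepsilon)$ such that $(H,\alpha,m,\eta)$ is a monoidal Hom-algebra, $(H,\alpha,\Delta,\varepsilon)$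 is a monoidal Hom-coalgebra, and $\Delta:H\to H\otimes H$, $\varepsilon:H\to k$ are multiplicative and preserve the unit (with componentwise product on $H\otimes H$). Hom-algebra: as a monoidal Hom-algebra, but $\alpha$ is only required to be linear. Hom-coalgebra: a $k$-module $C$ with linear maps $\alpha:C\to C$, $\Delta$, $\varepsilon$ such that $\Delta(\alpha(c))=\alpha(c_1)\otimes\alpha(c_2)$, $\alpha(c_1)\otimes\Delta(c_2)=\Delta(c_1)\otimes\alpha(c_2)$, $\varepsilon\circ\alpha=\varepsilon$, $\varepsilon(c_1)c_2=c_1\varepsilon(c_2)=\alpha(c)$. Hom-bialgebra: $(B,\alpha,m,\eta,\Delta,\varepsilon)$ that is both a Hom-algebra and a Hom-coalgebra (same $\alpha$), with $\Delta,\varepsilon$ multiplicative, compatible with the structure maps, and unit-preserving. Drinfeld twist for $H$: an element $\sigma=\sigma^{(1)}\otimes\sigma^{(2)}=\bar\sigma^{(1)}\otimes\bar\sigma^{(2)}\in H\otimes H$ (sums suppressed) that is invertible (there is $\varrho\in H\otimes H$ with $\sigma\varrho=\varrho\sigma=1_H\otimes 1_H$ for the componentwise product) and satisfies $(\alpha\otimes\alpha)(\sigma)=\sigma$; $(\varepsilon\otimes id)(\sigma)=(id\otimes\varepsilon)(\sigma)=1_H$; and $\sigma^{(1)}\otimes\bar\sigma^{(1)}\sigma^{(2)}_1\otimes\bar\sigma^{(2)}\sigma^{(2)}_2=\bar\sigma^{(1)}\sigma^{(1)}_1\otimes\bar\sigma^{(2)}\sigma^{(1)}_2\otimes\sigma^{(2)}$.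 *)

(* Defs.v *)
From HB Require Import structures.
From mathcomp Require Import all_boot all_algebra.
From mathcomp Require Import generic_quotient boolp.

Set Implicit Arguments.
Unset Strict Implicit.
Unset Printing Implicit Defensive.

Import GRing.Theory.
Local Open Scope quotient_scope.
Local Open Scope ring_scope.

Local Notation bilinear_map f := (bilinear_for *:%R *:%R f).

(* The tensor product of two modules over a commutative ring: finite formal
   sums of pure tensors (as sequences of pairs), modulo the congruence that
   makes concatenation commutative and the pairing bilinear; opposites come from
   scaling by -1, so [tens_zero] is needed and a free group is not. The lemmas
   [lift_tensor] and [tensor_ext] below are its universal property. *)
Section TensorProduct.
Variables (k : comNzRingType) (U V : lmodType k).

Inductive tens_rel : seq (U * V) -> seq (U * V) -> Prop :=
| tens_refl s : tens_rel s s
| tens_sym s t : tens_rel s t -> tens_rel t s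
| tens_trans s t r : tens_rel s t -> tens_rel t r -> tens_rel s r
| tens_cat s s' t t' :
    tens_rel s s' -> tens_rel t t' -> tens_rel (s ++ t) (s' ++ t')
| tens_catC s t : tens_rel (s ++ t) (t ++ s)
| tens_addl u u' v : tens_rel [:: (u + u', v)] [:: (u, v); (u', v)]
| tens_addr u v v' : tens_rel [:: (u, v + v')] [:: (u, v); (u, v')]
| tens_scale a u v : tens_rel [:: (a *: u, v)] [:: (u, a *: v)]
| tens_zero v : tens_rel [:: (0, v)] [::].

Definition tens_eqb (s t : seq (U * V)) : bool := `[< tens_rel s t >].

Lemma tens_eqb_refl : reflexive tens_eqb.
Proof. by move=> s; apply/asboolP; exact: tens_refl. Qed.

Lemma tens_eqb_sym : symmetric tens_eqb.
Proof. by move=> s t; apply/asboolP/asboolP; exact: tens_sym. Qed.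

Lemma tens_eqb_trans : transitive tens_eqb.
Proof.
move=> t s r /asboolP st /asboolP tr; apply/asboolP; exact: tens_trans st tr.
Qed.

Canonical tens_equiv := EquivRel tens_eqb tens_eqb_refl tens_eqb_sym tens_eqb_trans.

Definition tensor_product : Type := {eq_quot tens_equiv}.

HB.instance Definition _ := Choice.copy tensor_product {eq_quot tens_equiv}.

Definition tens_class (s : seq (U * V)) : tensor_product :=
  \pi_{eq_quot tens_equiv} s.
Definition tens_repr (x : tensor_product) : seq (U * V) :=
  repr (x : {eq_quot tens_equiv}).

Lemma tens_reprK : cancel tens_repr tens_class.
Proof. by move=> x; rewrite /tens_class /tens_repr; exact: (@reprK _ {eq_quot tens_equiv}). Qed.

Lemma tens_classP s t : tens_class s = tens_class t <-> tens_rel s t.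
Proof.
split=> [/eqmodP/asboolP //|st]; apply/eqmodP.
exact/asboolP.
Qed.

Lemma tens_reprP s : tens_rel (tens_repr (tens_class s)) s.
Proof. by apply/tens_classP; rewrite tens_reprK. Qed.

Definition tens_add (x y : tensor_product) : tensor_product :=
  tens_class (tens_repr x ++ tens_repr y).
Definition tens_scal (a : k) (x : tensor_product) : tensor_product :=
  tens_class [seq (a *: p.1, p.2) | p <- tens_repr x].
Definition tens_opp (x : tensor_product) : tensor_product := tens_scal (-1) x.

Lemma tens_addE s t :
  tens_add (tens_class s) (tens_class t) = tens_class (s ++ t).
Proof. by apply/tens_classP; apply: tens_cat; apply: tens_reprP. Qed.

Lemma tens_rel_scal (a : k) s t : tens_rel s t ->
  tens_rel [seq (a *: p.1, p.2) | p <- s] [seq (a *: p.1, p.2) | p <- t].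
Proof.
elim=> {s t} /=.
- by move=> s; exact: tens_refl.
- by move=> s t _; exact: tens_sym.
- by move=> s t r _ st _; exact: tens_trans.
- by move=> s s' t t' _ ss' _ tt'; rewrite !map_cat; exact: tens_cat.
- by move=> s t; rewrite !map_cat; exact: tens_catC.
- by move=> u u' v; rewrite scalerDr; exact: tens_addl.
- by move=> u v v'; exact: tens_addr.
- move=> b u v; rewrite scalerA mulrC -scalerA; exact: tens_scale.
- by move=> v; rewrite scaler0; exact: tens_zero.
Qed.

Lemma tens_scalE (a : k) s :
  tens_scal a (tens_class s) = tens_class [seq (a *: p.1, p.2) | p <- s].
Proof. by apply/tens_classP; apply: tens_rel_scal; exact: tens_reprP. Qed.

Lemma tens_addA : associative tens_add.
Proof.
move=> x y z.
by rewrite -[x]tens_reprK -[y]tens_reprK -[z]tens_reprK !tens_addE catA.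
Qed.

Lemma tens_addC : commutative tens_add.
Proof.
move=> x y; rewrite -[x]tens_reprK -[y]tens_reprK !tens_addE.
by apply/tens_classP; exact: tens_catC.
Qed.

Lemma tens_add0 : left_id (tens_class [::]) tens_add.
Proof. by move=> x; rewrite -[x]tens_reprK tens_addE. Qed.

Lemma tens_scal_addl (x : tensor_product) (a b : k) :
  tens_scal (a + b) x = tens_add (tens_scal a x) (tens_scal b x).
Proof.
rewrite -[x]tens_reprK !tens_scalE tens_addE; apply/tens_classP.
elim: (tens_repr x) => [|[u v] s IHs] /=; first exact: tens_refl.
set s1 := [seq _ | p <- s] in IHs *; set s2 := map _ s; set s3 := map _ s in IHs *.
apply: (tens_trans (t := [:: (a *: u, v); (b *: u, v)] ++ (s2 ++ s3))).
  rewrite scalerDl; apply: (@tens_cat [:: _]) => //; exact: tens_addl.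
apply: (@tens_cat [:: (a *: u, v)] [:: (a *: u, v)]); first exact: tens_refl.
rewrite -cat_cons -cat1s -[_ :: s3]cat1s [RHS in tens_rel _ RHS]catA.
by apply: tens_cat; [exact: tens_catC | exact: tens_refl].
Qed.

Lemma tens_scal0 x : tens_scal 0 x = tens_class [::].
Proof.
rewrite -[x]tens_reprK tens_scalE; apply/tens_classP.
elim: (tens_repr x) => [|[u v] s IHs] /=; first exact: tens_refl.
by apply: (@tens_cat [:: _] [::]) IHs; rewrite scale0r; exact: tens_zero.
Qed.

Lemma tens_scal1 : left_id 1 tens_scal.
Proof.
move=> x; rewrite -[x]tens_reprK tens_scalE; congr tens_class.
by rewrite -[RHS]map_id; apply: eq_map => -[u v] /=; rewrite scale1r.
Qed.

Lemma tens_addN : left_inverse (tens_class [::]) tens_opp tens_add.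
Proof.
move=> x; rewrite /tens_opp -{2}[x]tens_scal1 -tens_scal_addl.
by rewrite addNr tens_scal0.
Qed.

HB.instance Definition _ :=
  GRing.isZmodule.Build tensor_product tens_addA tens_addC tens_add0 tens_addN.

Lemma tens_scalA (a b : k) (x : tensor_product) :
  tens_scal a (tens_scal b x) = tens_scal (a * b) x.
Proof.
rewrite -[x]tens_reprK !tens_scalE; congr tens_class.
by rewrite -map_comp; apply: eq_map => -[u v] /=; rewrite scalerA.
Qed.

Lemma tens_scal_addr : right_distributive tens_scal +%R.
Proof.
move=> a x y; rewrite -[x]tens_reprK -[y]tens_reprK.
by rewrite [_ + _]tens_addE !tens_scalE [RHS]tens_addE map_cat.
Qed.

HB.instance Definition _ :=
  GRing.Zmodule_isLmodule.Build k tensor_product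
    tens_scalA tens_scal1 tens_scal_addr tens_scal_addl.

Definition tensor (u : U) (v : V) : tensor_product := tens_class [:: (u, v)].

Lemma tensor_is_bilinear : bilinear_map tensor.
Proof.
split=> [v a u u' | u a v v'] /=.
- rewrite /tensor [_ *: tens_class _]tens_scalE [RHS]tens_addE /=.
  by apply/tens_classP; exact: tens_addl.
- rewrite /tensor [_ *: tens_class _]tens_scalE [RHS]tens_addE /=.
  apply/tens_classP; apply: tens_trans (tens_addr _ _ _) _.
  apply: (@tens_cat [:: _] [:: _] [:: _] [:: _]); last exact: tens_refl.
  by apply: tens_sym; exact: tens_scale.
Qed.

HB.instance Definition _ :=
  bilinear_isBilinear.Build k _ _ _ *:%R *:%R tensor
    tensor_is_bilinear.

Lemma tens_class_sum s : tens_class s = \sum_(p <- s) tensor p.1 p.2.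
Proof.
elim: s => [|[u v] s IHs]; first by rewrite big_nil.
by rewrite big_cons -IHs [RHS]tens_addE.
Qed.

Lemma tensor_ind (P : tensor_product -> Prop) :
    P 0 -> (forall u v x, P x -> P (tensor u v + x)) ->
  forall x, P x.
Proof.
move=> P0 PD x; rewrite -[x]tens_reprK tens_class_sum.
elim: (tens_repr x) => [|[u v] s IHs]; first by rewrite big_nil.
by rewrite big_cons; exact: PD.
Qed.

Lemma tensor_ext (W : lmodType k) (f g : {linear tensor_product -> W}) :
  (forall u v, f (tensor u v) = g (tensor u v)) -> f =1 g.
Proof.
by move=> fg; elim/tensor_ind => [|u v x IHx]; rewrite ?linear0 // !linearD fg IHx.
Qed.

Section Lift.
Variables (W : lmodType k) (f : {bilinear U -> V -> W}).

Definition lift (x : tensor_product) : W :=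
  \sum_(p <- tens_repr x) f p.1 p.2.

Lemma tens_rel_lift s t : tens_rel s t ->
  \sum_(p <- s) f p.1 p.2 = \sum_(p <- t) f p.1 p.2.
Proof.
elim=> {s t} //=.
- by move=> s t r _ -> _ ->.
- by move=> s s' t t' _ ss' _ tt'; rewrite !big_cat /= ss' tt'.
- by move=> s t; rewrite !big_cat /= addrC.
- by move=> u u' v; rewrite !big_cons !big_nil /= !addr0 linearDl.
- by move=> u v v'; rewrite !big_cons !big_nil /= !addr0 linearDr.
- by move=> a u v; rewrite !big_cons !big_nil /= !addr0 linearZl_LR linearZr_LR.
- by move=> v; rewrite !big_cons !big_nil /= addr0 linear0l.
Qed.

Lemma lift_class s : lift (tens_class s) = \sum_(p <- s) f p.1 p.2.
Proof. by apply: tens_rel_lift; exact: tens_reprP. Qed.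

Lemma lift_is_linear : linear lift.
Proof.
move=> a x y; rewrite -[x]tens_reprK -[y]tens_reprK.
rewrite [_ *: tens_class _]tens_scalE [_ + tens_class _]tens_addE !lift_class.
rewrite big_cat big_map /= scaler_sumr; congr (_ + _).
by apply: eq_bigr => p _; rewrite linearZl_LR.
Qed.

HB.instance Definition _ :=
  GRing.isLinear.Build k _ _ *:%R lift lift_is_linear.

Lemma lift_tensor u v : lift (tensor u v) = f u v.
Proof. by rewrite lift_class big_cons big_nil addr0. Qed.

End Lift.

End TensorProduct.

(* [U ⊗ V] is the module, [u ⊗ₜ v] a pure tensor. *)
Notation "U ⊗ V" := (tensor_product U V)
  (at level 40, left associativity) : type_scope.
Notation "U ⊗ V" := (tensor_product U V) : ring_scope.
Notation "u ⊗ₜ v" := (tensor u v)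
  (at level 40, left associativity) : ring_scope.

Section TensorMaps.
Variable k : comNzRingType.

Section Bilinearity.
Variables (U V : lmodType k).

Lemma tensorPl a (u u' : U) (v : V) :
  (a *: u + u') ⊗ₜ v = a *: (u ⊗ₜ v) + u' ⊗ₜ v.
Proof. exact: linearPl. Qed.

Lemma tensorPr a (u : U) (v v' : V) :
  u ⊗ₜ (a *: v + v') = a *: (u ⊗ₜ v) + u ⊗ₜ v'.
Proof. exact: linearPr. Qed.

Lemma tensorDl (u u' : U) (v : V) : (u + u') ⊗ₜ v = u ⊗ₜ v + u' ⊗ₜ v.
Proof. exact: linearDl. Qed.

Lemma tensorDr (u : U) (v v' : V) : u ⊗ₜ (v + v') = u ⊗ₜ v + u ⊗ₜ v'.
Proof. exact: linearDr. Qed.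

Lemma tensorZl a (u : U) (v : V) : (a *: u) ⊗ₜ v = a *: (u ⊗ₜ v).
Proof. exact: linearZl_LR. Qed.

Lemma tensorZr a (u : U) (v : V) : u ⊗ₜ (a *: v) = a *: (u ⊗ₜ v).
Proof. exact: linearZr_LR. Qed.

End Bilinearity.

Section Map.
Variables (U V U' V' : lmodType k).
Variables (f : {linear U -> U'}) (g : {linear V -> V'}).

Definition tmap_fun (u : U) (v : V) : U' ⊗ V' := f u ⊗ₜ g v.

Lemma tmap_fun_bilinear : bilinear_map tmap_fun.
Proof.
by split=> [v a u u' | u a v v']; rewrite /tmap_fun linearP ?(tensorPl, tensorPr).
Qed.

HB.instance Definition _ :=
  bilinear_isBilinear.Build k _ _ _ *:%R *:%R tmap_fun tmap_fun_bilinear.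

Definition tmap : U ⊗ V -> U' ⊗ V' := lift tmap_fun.

HB.instance Definition _ := GRing.Linear.on tmap.

Lemma tmap_tensor u v : tmap (u ⊗ₜ v) = f u ⊗ₜ g v.
Proof. exact: lift_tensor. Qed.

End Map.

Section Assoc.
Variables (U V W : lmodType k).

Definition tassoc_fun1 (w : W) (u : U) (v : V) : U ⊗ (V ⊗ W) := u ⊗ₜ (v ⊗ₜ w).

Lemma tassoc_fun1_bilinear w : bilinear_map (tassoc_fun1 w).
Proof.
by split=> [v a u u' | u a v v']; rewrite /tassoc_fun1 !(tensorPl, tensorPr).
Qed.

HB.instance Definition _ w :=
  bilinear_isBilinear.Build k _ _ _ *:%R *:%R (tassoc_fun1 w)
    (tassoc_fun1_bilinear w).

Definition tassoc_fun (x : U ⊗ V) (w : W) : U ⊗ (V ⊗ W) :=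
  lift (tassoc_fun1 w) x.

Lemma tassoc_fun_bilinear : bilinear_map tassoc_fun.
Proof.
split=> [w a x x' | x a w w']; rewrite /tassoc_fun; first by rewrite linearP.
elim/tensor_ind: x => [|u v x IHx]; first by rewrite !linear0 /= scaler0 addr0.
rewrite !linearD /= IHx !lift_tensor /= /tassoc_fun1 !tensorPr scalerDr.
by rewrite addrACA.
Qed.

HB.instance Definition _ :=
  bilinear_isBilinear.Build k _ _ _ *:%R *:%R tassoc_fun
    tassoc_fun_bilinear.

Definition tassoc : (U ⊗ V) ⊗ W -> U ⊗ (V ⊗ W) := lift tassoc_fun.

HB.instance Definition _ := GRing.Linear.on tassoc.

Lemma tassoc_tensor u v w : tassoc ((u ⊗ₜ v) ⊗ₜ w) = u ⊗ₜ (v ⊗ₜ w).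
Proof. by rewrite /tassoc lift_tensor /= /tassoc_fun lift_tensor. Qed.

End Assoc.

Section Interchange.
Variables (U V W X : lmodType k).

Definition tswap_fun1 (u : U) (v : V) (w : W) (x : X) : (U ⊗ W) ⊗ (V ⊗ X) :=
  (u ⊗ₜ w) ⊗ₜ (v ⊗ₜ x).

Lemma tswap_fun1_bilinear u v : bilinear_map (tswap_fun1 u v).
Proof.
by split=> [x a w w' | w a x x']; rewrite /tswap_fun1 !(tensorPl, tensorPr).
Qed.

HB.instance Definition _ u v :=
  bilinear_isBilinear.Build k _ _ _ *:%R *:%R (tswap_fun1 u v)
    (tswap_fun1_bilinear u v).

Definition tswap_fun2 (y : W ⊗ X) (u : U) (v : V) : (U ⊗ W) ⊗ (V ⊗ X) :=
  lift (tswap_fun1 u v) y.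

Lemma tswap_fun2_bilinear y : bilinear_map (tswap_fun2 y).
Proof.
split=> [v a u u' | u a v v']; rewrite /tswap_fun2.
all: elim/tensor_ind: y => [|w x y IHy]; first by rewrite !linear0 /= scaler0 addr0.
all: rewrite !linearD /= IHy !lift_tensor /= /tswap_fun1 !(tensorPl, tensorPr).
all: by rewrite scalerDr addrACA.
Qed.

HB.instance Definition _ y :=
  bilinear_isBilinear.Build k _ _ _ *:%R *:%R (tswap_fun2 y)
    (tswap_fun2_bilinear y).

Definition tswap_fun (z : U ⊗ V) (y : W ⊗ X) : (U ⊗ W) ⊗ (V ⊗ X) :=
  lift (tswap_fun2 y) z.

Lemma tswap_fun_bilinear : bilinear_map tswap_fun.
Proof.
split=> [y a z z' | z a y y']; rewrite /tswap_fun; first by rewrite linearP.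
elim/tensor_ind: z => [|u v z IHz]; first by rewrite !linear0 /= scaler0 addr0.
rewrite !linearD /= IHz !lift_tensor /= /tswap_fun2 linearP scalerDr.
by rewrite addrACA.
Qed.

HB.instance Definition _ :=
  bilinear_isBilinear.Build k _ _ _ *:%R *:%R
    tswap_fun tswap_fun_bilinear.

Definition tswap : (U ⊗ V) ⊗ (W ⊗ X) -> (U ⊗ W) ⊗ (V ⊗ X) := lift tswap_fun.

HB.instance Definition _ := GRing.Linear.on tswap.

Lemma tswap_tensor u v w x :
  tswap ((u ⊗ₜ v) ⊗ₜ (w ⊗ₜ x)) = (u ⊗ₜ w) ⊗ₜ (v ⊗ₜ x).
Proof.
by rewrite /tswap lift_tensor /= /tswap_fun lift_tensor /= /tswap_fun2 lift_tensor.
Qed.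

End Interchange.

Section Units.
Variable U : lmodType k.

Definition lunit_fun (a : k^o) (u : U) : U := (a : k) *: u.
Definition runit_fun (u : U) (a : k^o) : U := (a : k) *: u.

Lemma lunit_fun_bilinear : bilinear_map lunit_fun.
Proof.
split=> [u a b c | b a u v]; rewrite /lunit_fun.
- by rewrite scalerDl; congr (_ + _); rewrite /= scalerA.
- by rewrite scalerDr /= !scalerA mulrC.
Qed.

Lemma runit_fun_bilinear : bilinear_map runit_fun.
Proof. by have [l r] := lunit_fun_bilinear; split=> [b|u]; [exact: r|exact: l]. Qed.

HB.instance Definition _ :=
  bilinear_isBilinear.Build k _ _ _ *:%R *:%R lunit_fun lunit_fun_bilinear.
HB.instance Definition _ :=
  bilinear_isBilinear.Build k _ _ _ *:%R *:%R runit_fun runit_fun_bilinear.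

Definition lunit : k^o ⊗ U -> U := lift lunit_fun.
Definition runit : U ⊗ k^o -> U := lift runit_fun.

HB.instance Definition _ := GRing.Linear.on lunit.
HB.instance Definition _ := GRing.Linear.on runit.

Lemma lunit_tensor (a : k^o) u : lunit (a ⊗ₜ u) = (a : k) *: u.
Proof. exact: lift_tensor. Qed.

Lemma runit_tensor u (a : k^o) : runit (u ⊗ₜ a) = (a : k) *: u.
Proof. exact: lift_tensor. Qed.

End Units.

Section ComponentwiseProduct.
Variables (A : lmodType k) (m : {linear A ⊗ A -> A}).

Definition tmul (x y : A ⊗ A) : A ⊗ A := tmap m m (tswap (x ⊗ₜ y)).

Lemma tmul_is_bilinear : bilinear_map tmul.
Proof.
by split=> [y a x x' | x a y y']; rewrite /tmul ?(tensorPl, tensorPr) !linearP.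
Qed.

HB.instance Definition _ :=
  bilinear_isBilinear.Build k _ _ _ *:%R *:%R tmul
    tmul_is_bilinear.

Lemma tmul_tensor a b c d :
  tmul (a ⊗ₜ b) (c ⊗ₜ d) = m (a ⊗ₜ c) ⊗ₜ m (b ⊗ₜ d).
Proof. by rewrite /tmul tswap_tensor tmap_tensor. Qed.

End ComponentwiseProduct.

End TensorMaps.

Record linear_aut (k : comNzRingType) (V : lmodType k) := LinearAut {
  aut_fun :> {linear V -> V};
  aut_inv : {linear V -> V};
  aut_funK : cancel aut_fun aut_inv;
  aut_invK : cancel aut_inv aut_fun
}.

Section HomStructures.
Variable k : comNzRingType.

Record hom_algebra (A : lmodType k) (alpha : {linear A -> A})
    (m : {linear A ⊗ A -> A}) (eta : {linear k^o -> A}) : Prop := HomAlgebra {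
  hom_algebraM : forall a b, alpha (m (a ⊗ₜ b)) = m (alpha a ⊗ₜ alpha b);
  hom_algebraA : forall a b c,
    m (alpha a ⊗ₜ m (b ⊗ₜ c)) = m (m (a ⊗ₜ b) ⊗ₜ alpha c);
  hom_algebra1 : alpha (eta 1) = eta 1;
  hom_algebra1l : forall a, m (eta 1 ⊗ₜ a) = alpha a;
  hom_algebra1r : forall a, m (a ⊗ₜ eta 1) = alpha a
}.

Definition monoidal_hom_algebra (A : lmodType k) (alpha : linear_aut A)
    (m : {linear A ⊗ A -> A}) (eta : {linear k^o -> A}) : Prop :=
  hom_algebra alpha m eta.

Record hom_coalgebra (C : lmodType k) (alpha : {linear C -> C})
    (Delta : {linear C -> C ⊗ C}) (eps : {linear C -> k^o}) : Prop :=
  HomCoalgebra {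
  hom_coalgebraM : forall c, Delta (alpha c) = tmap alpha alpha (Delta c);
  hom_coalgebraA : forall c,
    tmap alpha Delta (Delta c) = tassoc (tmap Delta alpha (Delta c));
  hom_coalgebra1 : forall c, eps (alpha c) = eps c;
  hom_coalgebra1l : forall c, lunit (tmap eps idfun (Delta c)) = alpha c;
  hom_coalgebra1r : forall c, runit (tmap idfun eps (Delta c)) = alpha c
}.

Record monoidal_hom_coalgebra (C : lmodType k) (gamma : linear_aut C)
    (Delta : {linear C -> C ⊗ C}) (eps : {linear C -> k^o}) : Prop :=
  MonoidalHomCoalgebra {
  monoidal_hom_coalgebraM : forall c,
    Delta (gamma c) = tmap gamma gamma (Delta c);
  monoidal_hom_coalgebraA : forall c,
    tmap (aut_inv gamma) Delta (Delta c)
    = tassoc (tmap Delta (aut_inv gamma) (Delta c));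
  monoidal_hom_coalgebra1 : forall c, eps (gamma c) = eps c;
  monoidal_hom_coalgebra1l : forall c,
    lunit (tmap eps idfun (Delta c)) = aut_inv gamma c;
  monoidal_hom_coalgebra1r : forall c,
    runit (tmap idfun eps (Delta c)) = aut_inv gamma c
}.

Record comul_counit_multiplicative (B : lmodType k)
    (m : {linear B ⊗ B -> B}) (eta : {linear k^o -> B})
    (Delta : {linear B -> B ⊗ B}) (eps : {linear B -> k^o}) : Prop :=
  ComulCounitMultiplicative {
  comulM : forall a b, Delta (m (a ⊗ₜ b)) = tmul m (Delta a) (Delta b);
  comul1 : Delta (eta 1) = eta 1 ⊗ₜ eta 1;
  counitM : forall a b, eps (m (a ⊗ₜ b)) = (eps a : k) * eps b;
  counit1 : eps (eta 1) = 1
}.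

(* Compatibility of Delta and eps with alpha is part of [hom_coalgebra]. *)
Record hom_bialgebra (B : lmodType k) (alpha : {linear B -> B})
    (m : {linear B ⊗ B -> B}) (eta : {linear k^o -> B})
    (Delta : {linear B -> B ⊗ B}) (eps : {linear B -> k^o}) : Prop :=
  HomBialgebra {
  hom_bialgebra_algebra : hom_algebra alpha m eta;
  hom_bialgebra_coalgebra : hom_coalgebra alpha Delta eps;
  hom_bialgebra_compat : comul_counit_multiplicative m eta Delta eps
}.

Record monoidal_hom_bialgebra (H : lmodType k) (alpha : linear_aut H)
    (m : {linear H ⊗ H -> H}) (eta : {linear k^o -> H})
    (Delta : {linear H -> H ⊗ H}) (eps : {linear H -> k^o}) : Prop :=
  MonoidalHomBialgebra {
  monoidal_hom_bialgebra_algebra : monoidal_hom_algebra alpha m eta;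
  monoidal_hom_bialgebra_coalgebra : monoidal_hom_coalgebra alpha Delta eps;
  monoidal_hom_bialgebra_compat : comul_counit_multiplicative m eta Delta eps
}.

Section Twist.
Variables (H : lmodType k) (alpha : linear_aut H).
Variables (m : {linear H ⊗ H -> H}) (eta : {linear k^o -> H}).
Variables (Delta : {linear H -> H ⊗ H}) (eps : {linear H -> k^o}).

Definition tensor_inverse (sigma rho : H ⊗ H) : Prop :=
  tmul m sigma rho = eta 1 ⊗ₜ eta 1 /\ tmul m rho sigma = eta 1 ⊗ₜ eta 1.

Definition left_twist (sigma : H ⊗ H) (x : H) : H ⊗ H :=
  tmul m sigma (Delta x).

Lemma left_twist_is_linear sigma : linear (left_twist sigma).
Proof. by move=> a x y; rewrite /left_twist linearP linearPr. Qed.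

HB.instance Definition _ sigma :=
  GRing.isLinear.Build k _ _ *:%R (left_twist sigma)
    (left_twist_is_linear sigma).

Definition twisted_comul (sigma rho : H ⊗ H) (x : H) : H ⊗ H :=
  tmul m (tmul m sigma (Delta x)) rho.

Lemma twisted_comul_is_linear sigma rho : linear (twisted_comul sigma rho).
Proof. by move=> a x y; rewrite /twisted_comul linearP linearPr linearPl. Qed.

HB.instance Definition _ sigma rho :=
  GRing.isLinear.Build k _ _ *:%R (twisted_comul sigma rho)
    (twisted_comul_is_linear sigma rho).

(* In [twist_cocycle], (id ⊗ left_twist sigma)(sigma) is
   sigma1 ⊗ sigma1' sigma2_1 ⊗ sigma2' sigma2_2, where the primes mark a second
   copy of sigma. *)
Record drinfeld_twist (sigma : H ⊗ H) : Prop := DrinfeldTwist {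
  twist_invertible : exists rho, tensor_inverse sigma rho;
  twist_alpha : tmap alpha alpha sigma = sigma;
  twist_counitl : lunit (tmap eps idfun sigma) = eta 1;
  twist_counitr : runit (tmap idfun eps sigma) = eta 1;
  twist_cocycle :
    tmap idfun (left_twist sigma) sigma
    = tassoc (tmap (left_twist sigma) idfun sigma)
}.

End Twist.

End HomStructures.

(* Main.v *)
(* The product [a ∘ b = alpha^-1(a b)] and the coproduct [Delta ∘ alpha] turn a
   monoidal Hom-bialgebra into an ordinary bialgebra with automorphism [alpha],
   for which [sigma] is an ordinary Drinfeld twist. The classical twisting
   argument applies, and composing the product and the twisted coproduct of the
   result with [alpha] (Yau's twist) gives back [m] and [Delta^sigma]. *)
Require Import Defs.
From HB Require Import structures.
From mathcomp Require Import all_boot all_algebra.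

Set Implicit Arguments.
Unset Strict Implicit.
Unset Printing Implicit Defensive.

Import GRing.Theory.
Local Open Scope ring_scope.

(** * Functoriality of the tensor product *)

Section TensorLemmas.
Variable k : comNzRingType.

Lemma tensor0l (U V : lmodType k) (v : V) : (0 : U) ⊗ₜ v = 0.
Proof. exact: linear0l. Qed.

Lemma tensor0r (U V : lmodType k) (u : U) : u ⊗ₜ (0 : V) = 0.
Proof. exact: linear0r. Qed.

Lemma eq_tmap (U V U' V' : lmodType k) (f f' : {linear U -> U'})
    (g g' : {linear V -> V'}) :
  f =1 f' -> g =1 g' -> tmap f g =1 tmap f' g'.
Proof. by move=> ff' gg'; apply: tensor_ext => u v /=; rewrite !tmap_tensor ff' gg'. Qed.

Lemma tmap_comp (U V U' V' U'' V'' : lmodType k)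
    (f : {linear U' -> U''}) (g : {linear V' -> V''})
    (f' : {linear U -> U'}) (g' : {linear V -> V'}) x :
  tmap f g (tmap f' g' x) = tmap (f \o f') (g \o g') x.
Proof.
by elim/tensor_ind: x => [|u v x IH]; rewrite ?linear0 // !linearD /= IH !tmap_tensor.
Qed.

Lemma tmap_id (U V : lmodType k) (x : U ⊗ V) : tmap idfun idfun x = x.
Proof. by elim/tensor_ind: x => [|u v x IH]; rewrite ?linear0 // linearD /= IH tmap_tensor. Qed.

End TensorLemmas.

(** * Tensor products of unital associative algebras and their morphisms *)

Section TensorProductOfAlgebras.
Variable k : comNzRingType.

Definition unital_assoc (A : lmodType k) (f : {linear A ⊗ A -> A}) (e : A) :=
  [/\ forall a b c, f (a ⊗ₜ f (b ⊗ₜ c)) = f (f (a ⊗ₜ b) ⊗ₜ c),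
      forall a, f (e ⊗ₜ a) = a & forall a, f (a ⊗ₜ e) = a].

(** Bracket [y x z] in the two possible ways. This will give the inverse form of the cocycle
    identity and the [alpha]-invariance of [rho]. *)
Lemma unital_assoc_inv_unique (A : lmodType k) (f : {linear A ⊗ A -> A}) (e : A)
    (x y z : A) :
  unital_assoc f e -> f (y ⊗ₜ x) = e -> f (x ⊗ₜ z) = e -> y = z.
Proof. by case=> fA f1 f2 yx xz; rewrite -[y]f2 -xz fA yx f1. Qed.

(** Allowing two different factors lets the construction be iterated on [H ⊗ (H ⊗ H)]. On a pure
    tensor [x ⊗ₜ y], [tprod m m] is convertible to [tmul m x y]. *)
Definition tprod (A B : lmodType k) (f : {linear A ⊗ A -> A})
    (g : {linear B ⊗ B -> B}) : (A ⊗ B) ⊗ (A ⊗ B) -> A ⊗ B :=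
  tmap f g \o @tswap k A B A B.

HB.instance Definition _ A B f g := GRing.Linear.on (@tprod A B f g).

Lemma tprod_tensor (A B : lmodType k) (f : {linear A ⊗ A -> A})
    (g : {linear B ⊗ B -> B}) a b c d :
  tprod f g ((a ⊗ₜ b) ⊗ₜ (c ⊗ₜ d)) = f (a ⊗ₜ c) ⊗ₜ g (b ⊗ₜ d).
Proof. by rewrite /tprod /= tswap_tensor tmap_tensor. Qed.

Lemma tprod_unital_assoc (A B : lmodType k) (f : {linear A ⊗ A -> A})
    (g : {linear B ⊗ B -> B}) e e' :
  unital_assoc f e -> unital_assoc g e' -> unital_assoc (tprod f g) (e ⊗ₜ e').
Proof.
case=> fA f1 f2 [gA g1 g2]; split=> [x y z|x|x].
- elim/tensor_ind: x => [|a b x IHx].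
    by rewrite !(tensor0l, linear0).
  rewrite !(tensorDl, linearD) /= IHx; congr (_ + _) => {x IHx}.
  elim/tensor_ind: y => [|c d y IHy].
    by rewrite !(tensor0l, tensor0r, linear0).
  rewrite !(tensorDl, tensorDr, linearD) /= IHy; congr (_ + _) => {y IHy}.
  elim/tensor_ind: z => [|p q z IHz].
    by rewrite !(tensor0l, tensor0r, linear0).
  rewrite !(tensorDl, tensorDr, linearD) /= IHz; congr (_ + _).
  by rewrite !tprod_tensor fA gA.
- elim/tensor_ind: x => [|a b x IHx]; first by rewrite tensor0r linear0.
  by rewrite tensorDr linearD /= IHx tprod_tensor f1 g1.
- elim/tensor_ind: x => [|a b x IHx]; first by rewrite tensor0l linear0.
  by rewrite tensorDl linearD /= IHx tprod_tensor f2 g2.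
Qed.

Definition mul_morph (A B : lmodType k) (f : {linear A ⊗ A -> A})
    (g : {linear B ⊗ B -> B}) (h : A -> B) :=
  forall x y, h (f (x ⊗ₜ y)) = g (h x ⊗ₜ h y).

Lemma mul_morph_tensor (A B C : lmodType k) (f : {linear A ⊗ A -> A})
    (g : {linear B ⊗ B -> B}) (p : {linear C ⊗ C -> C})
    (h : {linear A ⊗ B -> C}) :
  (forall a b c d, h (f (a ⊗ₜ c) ⊗ₜ g (b ⊗ₜ d)) = p (h (a ⊗ₜ b) ⊗ₜ h (c ⊗ₜ d))) ->
  mul_morph (tprod f g) p h.
Proof.
move=> hM x y; elim/tensor_ind: x => [|a b x IHx].
  by rewrite !(tensor0l, linear0).
rewrite !(tensorDl, linearD) /= IHx; congr (_ + _) => {x IHx}.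
elim/tensor_ind: y => [|c d y IHy]; first by rewrite !(tensor0r, linear0).
by rewrite !(tensorDr, linearD) /= IHy tprod_tensor hM.
Qed.

Lemma tmap_mul_morph (A B A' B' : lmodType k) (f : {linear A ⊗ A -> A})
    (g : {linear B ⊗ B -> B}) (f' : {linear A' ⊗ A' -> A'})
    (g' : {linear B' ⊗ B' -> B'}) (h : {linear A -> A'}) (h' : {linear B -> B'}) :
  mul_morph f f' h -> mul_morph g g' h' ->
  mul_morph (tprod f g) (tprod f' g') (tmap h h').
Proof.
move=> hM hM'; apply: mul_morph_tensor => a b c d /=.
by rewrite !tmap_tensor tprod_tensor hM hM'.
Qed.

(** Rebracketing respects products, so identities proved in [(H ⊗ H) ⊗ H] can be moved to the one
    algebra [H ⊗ (H ⊗ H)], where both sides of coassociativity are compared. *)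
Lemma tassoc_mul_morph (A B C : lmodType k) (f : {linear A ⊗ A -> A})
    (g : {linear B ⊗ B -> B}) (h : {linear C ⊗ C -> C}) :
  mul_morph (tprod (tprod f g) h) (tprod f (tprod g h)) (@tassoc k A B C).
Proof.
apply: mul_morph_tensor => x c y d /=.
elim/tensor_ind: x => [|a b x IHx]; first by rewrite !(tensor0l, linear0).
rewrite !(tensorDl, linearD) /= IHx; congr (_ + _) => {x IHx}.
elim/tensor_ind: y => [|p q y IHy]; first by rewrite !(tensor0l, tensor0r, linear0).
rewrite !(tensorDl, tensorDr, linearD) /= IHy; congr (_ + _).
by rewrite !(tprod_tensor, tassoc_tensor) /= tprod_tensor.
Qed.

End TensorProductOfAlgebras.

(** * The classical Drinfeld twist of an ordinary bialgebra *)

(* A Hom-bialgebra with structure map [idfun] is an ordinary bialgebra. *)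
Section OrdinaryTwist.
Variables (k : comNzRingType) (H : lmodType k).
Variables (m : {linear H ⊗ H -> H}) (eta : {linear k^o -> H}).
Variables (Delta : {linear H -> H ⊗ H}) (eps : {linear H -> k^o}).
Hypothesis bialgH : hom_bialgebra idfun m eta Delta eps.

Lemma bialgebra_unital_assoc : unital_assoc m (eta 1).
Proof. by case: bialgH => -[_ mA _ m1 m2] _ _; split. Qed.

Lemma counitl_mul_morph : mul_morph (tprod m m) m (@lunit k H \o tmap eps idfun).
Proof.
case: bialgH => _ _ [_ _ epsM _]; apply: mul_morph_tensor => a b c d /=.
rewrite !tmap_tensor !lunit_tensor epsM /= tensorZl tensorZr !linearZ /=.
by rewrite scalerA.
Qed.

Lemma counitr_mul_morph : mul_morph (tprod m m) m (@runit k H \o tmap idfun eps).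
Proof.
case: bialgH => _ _ [_ _ epsM _]; apply: mul_morph_tensor => a b c d /=.
rewrite !tmap_tensor !runit_tensor epsM /= tensorZl tensorZr !linearZ /=.
by rewrite scalerA.
Qed.

Variables sigma rho : H ⊗ H.
Hypothesis inv_sigma : tensor_inverse m eta sigma rho.

Let m2 : {linear _ -> _} := tprod m m.
Let m3 : {linear _ -> _} := tprod m m2.
Let one2 : H ⊗ H := eta 1 ⊗ₜ eta 1.
Let one3 : H ⊗ (H ⊗ H) := eta 1 ⊗ₜ one2.
Let D : {linear H -> H ⊗ H} := twisted_comul m Delta sigma rho.

Let ua2 : unital_assoc m2 one2.
Proof. by apply: tprod_unital_assoc; exact: bialgebra_unital_assoc. Qed.

Let ua3 : unital_assoc m3 one3.
Proof. by apply: tprod_unital_assoc => //; exact: bialgebra_unital_assoc. Qed.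

Lemma twisted_comulE x : D x = m2 (m2 (sigma ⊗ₜ Delta x) ⊗ₜ rho).
Proof. by []. Qed.

(** In [sigma Delta(x) rho sigma Delta(y) rho] the inner factor [rho sigma] cancels. *)
Lemma twisted_comulM x y : D (m (x ⊗ₜ y)) = m2 (D x ⊗ₜ D y).
Proof.
case: bialgH => _ _ [DeltaM _ _ _]; case: inv_sigma => _ rs.
have [mA m1 _] := ua2.
rewrite !twisted_comulE DeltaM -[tmul _ _ _]/(m2 (_ ⊗ₜ _)).
rewrite -[RHS]mA; rewrite [m2 (rho ⊗ₜ _)]mA [m2 (rho ⊗ₜ m2 _)]mA.
by rewrite -[tmul m rho sigma]/(m2 (rho ⊗ₜ sigma)) in rs; rewrite rs m1 !mA.
Qed.

(** Only the last two legs are multiplied; the unit [eta 1] on the first leg turns this into one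
    product in the threefold tensor algebra. *)
Lemma tmap_id_left_twist x :
  tmap idfun (left_twist m Delta sigma) x
  = m3 ((eta 1 ⊗ₜ sigma) ⊗ₜ tmap idfun Delta x).
Proof.
have [_ m1 _] := bialgebra_unital_assoc.
elim/tensor_ind: x => [|u v x IH]; first by rewrite !(linear0, tensor0r).
rewrite !(linearD, tensorDr) /= IH; congr (_ + _).
by rewrite !tmap_tensor tprod_tensor m1.
Qed.

Lemma tmap_left_twist_id x :
  tassoc (tmap (left_twist m Delta sigma) idfun x)
  = m3 (tassoc (sigma ⊗ₜ eta 1) ⊗ₜ tassoc (tmap Delta idfun x)).
Proof.
have [_ m1 _] := bialgebra_unital_assoc.
rewrite /m3 /m2 -tassoc_mul_morph; congr tassoc.
elim/tensor_ind: x => [|u v x IH]; first by rewrite !(linear0, tensor0r).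
rewrite !(linearD, tensorDr) /= IH; congr (_ + _).
by rewrite !tmap_tensor tprod_tensor m1.
Qed.

Lemma tmap_id_twisted_comul x :
  tmap idfun D x
  = m3 (m3 ((eta 1 ⊗ₜ sigma) ⊗ₜ tmap idfun Delta x) ⊗ₜ (eta 1 ⊗ₜ rho)).
Proof.
have [_ m1 mr] := bialgebra_unital_assoc.
elim/tensor_ind: x => [|u v x IH].
  by rewrite !(linear0, tensor0l, tensor0r).
rewrite !(linearD, tensorDl, tensorDr) /= IH; congr (_ + _).
by rewrite !tmap_tensor !tprod_tensor m1 mr.
Qed.

Lemma tmap_twisted_comul_id x :
  tassoc (tmap D idfun x)
  = m3 (m3 (tassoc (sigma ⊗ₜ eta 1) ⊗ₜ tassoc (tmap Delta idfun x))
        ⊗ₜ tassoc (rho ⊗ₜ eta 1)).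
Proof.
have [_ m1 mr] := bialgebra_unital_assoc.
rewrite /m3 /m2 -!tassoc_mul_morph; congr tassoc.
elim/tensor_ind: x => [|u v x IH].
  by rewrite !(linear0, tensor0l, tensor0r).
rewrite !(linearD, tensorDl, tensorDr) /= IH; congr (_ + _).
by rewrite !tmap_tensor !tprod_tensor m1 mr.
Qed.

Hypothesis cocycle :
  tmap idfun (left_twist m Delta sigma) sigma
  = tassoc (tmap (left_twist m Delta sigma) idfun sigma).

Let S1 : H ⊗ (H ⊗ H) := eta 1 ⊗ₜ sigma.
Let S2 : H ⊗ (H ⊗ H) := tassoc (sigma ⊗ₜ eta 1).
Let R1 : H ⊗ (H ⊗ H) := eta 1 ⊗ₜ rho.
Let R2 : H ⊗ (H ⊗ H) := tassoc (rho ⊗ₜ eta 1).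
Let D1 : {linear _ -> _} := tmap (@idfun H) Delta.
Let D2 : {linear _ -> _} := @tassoc k H H H \o tmap Delta (@idfun H).

(** The cocycle condition as an equation between products in an associative algebra, a form in which
    both sides can be inverted. *)
Let cocycle_mul : m3 (S1 ⊗ₜ D1 sigma) = m3 (S2 ⊗ₜ D2 sigma).
Proof. by rewrite -tmap_id_left_twist cocycle tmap_left_twist_id. Qed.

Let DeltaM : mul_morph m m2 Delta.
Proof. by case: bialgH => _ _ []. Qed.

Let D1M : mul_morph m2 m3 D1.
Proof. by apply: tmap_mul_morph; [| exact: DeltaM]. Qed.

Let D2M : mul_morph m2 m3 D2.
Proof.
move=> x y; rewrite /D2 /= -tassoc_mul_morph; congr tassoc.
by apply: tmap_mul_morph; [exact: DeltaM|].
Qed.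

Let mulSR : m2 (sigma ⊗ₜ rho) = one2. Proof. by case: inv_sigma. Qed.
Let mulRS : m2 (rho ⊗ₜ sigma) = one2. Proof. by case: inv_sigma. Qed.

Let comul_one : Delta (eta 1) = one2. Proof. by case: bialgH => _ _ []. Qed.

Let D1_one : D1 one2 = one3.
Proof. by rewrite /D1 /one2 /= tmap_tensor comul_one. Qed.

Let D2_one : D2 one2 = one3.
Proof. by rewrite /D2 /one2 /= tmap_tensor comul_one tassoc_tensor. Qed.

Let mulS1R1 : m3 (S1 ⊗ₜ R1) = one3.
Proof. by rewrite /m3 /S1 /R1 /= tprod_tensor mulSR; case: bialgebra_unital_assoc => _ ->. Qed.

Let mulR2S2 : m3 (R2 ⊗ₜ S2) = one3.
Proof.
rewrite /m3 /R2 /S2 -tassoc_mul_morph /= tprod_tensor mulRS /one2 /one3.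
by case: bialgebra_unital_assoc => _ -> _; rewrite tassoc_tensor.
Qed.

(* Both sides are inverse to the two members of the cocycle identity. *)
Let inverse_cocycle : m3 (D1 rho ⊗ₜ R1) = m3 (D2 rho ⊗ₜ R2).
Proof.
have [mA m1 _] := ua3; apply/esym.
apply: (unital_assoc_inv_unique (x := m3 (S1 ⊗ₜ D1 sigma)) ua3).
  rewrite cocycle_mul -mA [m3 (R2 ⊗ₜ _)]mA mulR2S2 m1.
  by rewrite -D2M mulRS D2_one.
rewrite -mA [m3 (D1 sigma ⊗ₜ _)]mA -D1M mulSR D1_one m1.
exact: mulS1R1.
Qed.

(** As [D1] and [D2] are multiplicative, the sides expand to [S1 D1(sigma) D1(Delta x) D1(rho) R1]
    and its analogue with index 2. The two left factors agree by the cocycle identity, the two right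
    ones by its inverse, and the middle ones by coassociativity of [Delta]. *)
Lemma twisted_comulA x : tmap idfun D (D x) = tassoc (tmap D idfun (D x)).
Proof.
have [mA _ _] := ua3; rewrite tmap_id_twisted_comul tmap_twisted_comul_id.
rewrite -/S1 -/R1 -/S2 -/R2 -/D1 -[tassoc (tmap Delta _ _)]/(D2 _).
rewrite twisted_comulE !D1M !D2M !mA cocycle_mul -!mA; congr (m3 (_ ⊗ₜ _)).
rewrite inverse_cocycle; congr (m3 (_ ⊗ₜ m3 (_ ⊗ₜ _))).
by case: bialgH => _ [_ coA _ _ _] _; exact: coA.
Qed.

Hypothesis counitl_sigma : lunit (tmap eps idfun sigma) = eta 1.
Hypothesis counitr_sigma : runit (tmap idfun eps sigma) = eta 1.

Lemma twisted_counitl x : lunit (tmap eps idfun (D x)) = x.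
Proof.
have [_ m1 mr] := bialgebra_unital_assoc.
pose l := @lunit k H \o tmap eps idfun; rewrite -[LHS]/(l _).
have lM : mul_morph m2 m l := counitl_mul_morph.
have ls : l sigma = eta 1 by [].
(* The inverse inherits the normalisation: [l rho = l sigma l rho = l (sigma rho) = eta 1]. *)
have lr : l rho = eta 1.
  rewrite -[LHS]m1 -ls -lM mulSR /l /one2 /= tmap_tensor lunit_tensor.
  by case: bialgH => _ _ [_ _ _ ->]; rewrite scale1r.
rewrite twisted_comulE lM lr mr lM ls m1.
by case: bialgH => _ [_ _ _ co1 _] _; exact: co1.
Qed.

Lemma twisted_counitr x : runit (tmap idfun eps (D x)) = x.
Proof.
have [_ m1 mr] := bialgebra_unital_assoc.
pose l := @runit k H \o tmap idfun eps; rewrite -[LHS]/(l _).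
have lM : mul_morph m2 m l := counitr_mul_morph.
have ls : l sigma = eta 1 by [].
have lr : l rho = eta 1.
  rewrite -[LHS]m1 -ls -lM mulSR /l /one2 /= tmap_tensor runit_tensor.
  by case: bialgH => _ _ [_ _ _ ->]; rewrite scale1r.
rewrite twisted_comulE lM lr mr lM ls m1.
by case: bialgH => _ [_ _ _ _ co1] _; exact: co1.
Qed.

Theorem drinfeld_twist_bialgebra :
  hom_bialgebra idfun m eta (twisted_comul m Delta sigma rho) eps.
Proof.
have [algH [_ _ eps1 _ _] [_ _ epsM epsu]] := bialgH.
split=> //.
  split=> // c; first by rewrite tmap_id.
  - exact: twisted_comulA.
  - exact: twisted_counitl.
  - exact: twisted_counitr.
split=> //; first exact: twisted_comulM.
rewrite -[LHS]/(m2 (m2 (sigma ⊗ₜ Delta (eta 1)) ⊗ₜ rho)) comul_one.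
by have [_ _ ->] := ua2.
Qed.

End OrdinaryTwist.

(** * Yau's twist, and its reversal for monoidal Hom-bialgebras *)

Section YauTwist.
Variables (k : comNzRingType) (H : lmodType k).

(** Since [alpha] commutes with all operations, each Hom-axiom is the ordinary one composed with a
    power of [alpha]. The new operations are given up to pointwise equality, because [twisted_comul]
    will agree with the composite only in that sense. *)
Lemma yau_twist (alpha : {linear H -> H}) (m m' : {linear H ⊗ H -> H})
    (eta : {linear k^o -> H}) (Delta Delta' : {linear H -> H ⊗ H})
    (eps : {linear H -> k^o}) :
  hom_bialgebra idfun m eta Delta eps ->
  mul_morph m m alpha -> alpha (eta 1) = eta 1 ->
  (forall c, Delta (alpha c) = tmap alpha alpha (Delta c)) ->
  (forall c, eps (alpha c) = eps c) ->
  m' =1 alpha \o m -> Delta' =1 Delta \o alpha ->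
  hom_bialgebra alpha m' eta Delta' eps.
Proof.
move=> [[_ /= mA _ m1 mr] [_ /= coA _ co1 cor] [DM D1 epsM eps1]].
move=> aM a1 aD aeps m'E D'E; split.
- split=> // [a b|a b c|a|a]; rewrite !m'E /=.
  + by rewrite !aM.
  + by rewrite !aM mA.
  + by rewrite m1.
  + by rewrite mr.
- split=> // c; rewrite !D'E /=.
  + by rewrite aD.
  (* Both sides equal the ordinary threefold coproduct of [alpha (alpha c)]: the structure map on
     one leg and the [alpha] inside [Delta'] on the other form [tmap alpha alpha]. *)
  + transitivity (tmap idfun Delta (Delta (alpha (alpha c)))).
      by rewrite [in RHS]aD tmap_comp; apply: eq_tmap.
    by rewrite coA; congr tassoc; rewrite [in LHS]aD tmap_comp; apply: eq_tmap.
  + by rewrite co1.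
  + by rewrite cor.
- split=> // [a b||a b].
  + rewrite !D'E m'E /= aD [Delta (alpha (m _))]aD DM.
    rewrite (_ : tmul m' _ _ = tmap alpha alpha (tmul m (Delta (alpha a)) (Delta (alpha b)))).
      by rewrite -!DM -!aD !aM.
    rewrite /tmul tmap_comp; exact: eq_tmap.
  + by rewrite D'E /= a1 D1.
  + by rewrite m'E /= aeps epsM.
Qed.

Variables (alpha : linear_aut H) (m : {linear H ⊗ H -> H}).
Variables (eta : {linear k^o -> H}) (Delta : {linear H -> H ⊗ H}).
Variable eps : {linear H -> k^o}.
Hypothesis bialgH : monoidal_hom_bialgebra alpha m eta Delta eps.

Local Notation beta := (aut_inv alpha).
Local Notation m' := (beta \o m).
Local Notation Delta' := (Delta \o alpha).

Lemma aut_inv_mul_morph : mul_morph m m beta.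
Proof.
case: bialgH => -[aM _ _ _ _] _ _ a b; apply: (can_inj (aut_funK alpha)).
by rewrite aM !aut_invK.
Qed.

Lemma aut_inv_unit : beta (eta 1) = eta 1.
Proof. by case: bialgH => -[_ _ a1 _ _] _ _; rewrite -{1}a1 aut_funK. Qed.

Lemma tmap_autK (x : H ⊗ H) : tmap beta beta (tmap alpha alpha x) = x.
Proof.
by rewrite tmap_comp -[RHS]tmap_id; apply: eq_tmap => u /=; rewrite aut_funK.
Qed.

Lemma comul_aut_inv c : tmap beta beta (Delta (alpha c)) = Delta c.
Proof. by case: bialgH => _ [-> _ _ _ _] _; rewrite tmap_autK. Qed.

Lemma tmul_untwist x y : tmul m' x y = tmap beta beta (tmul m x y).
Proof. by rewrite /tmul tmap_comp; apply: eq_tmap. Qed.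

Lemma tmap_aut_inv_tmul x y :
  tmap beta beta (tmul m x y) = tmul m (tmap beta beta x) (tmap beta beta y).
Proof. exact: (tmap_mul_morph aut_inv_mul_morph aut_inv_mul_morph). Qed.

(** The algebra axioms carry [alpha] and the coalgebra axioms its inverse. Hence the product is
    corrected by [beta] and the coproduct by [alpha], after which no structure map remains. *)
Lemma yau_untwist : hom_bialgebra idfun m' eta Delta' eps.
Proof.
have bM := aut_inv_mul_morph.
case: bialgH => -[aM mA a1 m1 mr] [aD coA aeps co1 cor] [DM D1 epsM eps1].
split.
- split=> //= [a b c|a|a].
  (* Hom-associativity needs outer arguments of the form [alpha _], so [a] and [c] are written as
     images of [alpha]. *)
  + rewrite -[a](aut_invK alpha) -[c](aut_invK alpha).
    by rewrite [beta (m (b ⊗ₜ _))]bM [beta (m (_ ⊗ₜ b))]bM !aut_funK mA.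
  + by rewrite m1 aut_funK.
  + by rewrite mr aut_funK.
- split=> //= c.
  + by rewrite tmap_id.
  + transitivity (tmap beta Delta (Delta (alpha (alpha c)))).
      rewrite [in RHS]aD tmap_comp; apply: eq_tmap => // u /=.
      by rewrite aut_funK.
    rewrite coA; congr tassoc; rewrite [in LHS]aD tmap_comp.
    by apply: eq_tmap => // u /=; rewrite aut_funK.
  + by rewrite co1 aut_funK.
  + by rewrite cor aut_funK.
- split=> //= [a b||a b].
  + by rewrite aut_invK tmul_untwist -DM -aM comul_aut_inv.
  + by rewrite a1.
  + by rewrite -aeps aut_invK.
Qed.

End YauTwist.

(** * Transfer of the classical twist to the monoidal Hom-bialgebra *)

Theorem theorem4p6 (k : comNzRingType)
    (char0 : forall n : nat, n.+1%:R != 0 :> k)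
    (H : lmodType k) (alpha : linear_aut H)
    (m : {linear H ⊗ H -> H}) (eta : {linear k^o -> H})
    (Delta : {linear H -> H ⊗ H}) (eps : {linear H -> k^o})
    (bialgH : monoidal_hom_bialgebra alpha m eta Delta eps)
    (sigma rho : H ⊗ H)
    (twist_sigma : drinfeld_twist alpha m eta Delta eps sigma)
    (inv_sigma : tensor_inverse m eta sigma rho) :
  hom_bialgebra alpha m eta (twisted_comul m Delta sigma rho) eps.
Proof.
pose m' : {linear H ⊗ H -> H} := aut_inv alpha \o m.
pose Delta' : {linear H -> H ⊗ H} := Delta \o alpha.
have bialgH' : hom_bialgebra idfun m' eta Delta' eps := yau_untwist bialgH.
have [_ a_sigma counitl counitr cocycle] := twist_sigma.
have [[_ _ a1 _ _] [aD _ aeps _ _] _] := bialgH.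
have [sr rs] := inv_sigma.
have m'E x y : tmul m' x y = tmap (aut_inv alpha) (aut_inv alpha) (tmul m x y).
  exact: tmul_untwist.
have b_one : tmap (aut_inv alpha) (aut_inv alpha) (eta 1 ⊗ₜ eta 1)
    = eta 1 ⊗ₜ eta 1.
  by rewrite tmap_tensor (aut_inv_unit bialgH).
have sr' : tmul m' sigma rho = eta 1 ⊗ₜ eta 1 by rewrite m'E sr.
have rs' : tmul m' rho sigma = eta 1 ⊗ₜ eta 1 by rewrite m'E rs.
have aM' : mul_morph m' m' alpha.
  by move=> x y; rewrite /= aut_invK (aut_inv_mul_morph bialgH) !aut_funK.
have aaM x y : tmap alpha alpha (tmul m' x y)
    = tmul m' (tmap alpha alpha x) (tmap alpha alpha y).
  exact: (tmap_mul_morph aM' aM').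
(* As [alpha] fixes [sigma] and is multiplicative, the image of [rho] is again an inverse of
   [sigma]. *)
have a_rho : tmap alpha alpha rho = rho.
  have ua := bialgebra_unital_assoc bialgH'.
  apply: (unital_assoc_inv_unique (tprod_unital_assoc ua ua) (x := sigma)).
    rewrite -[LHS]/(tmul m' _ _) -[X in tmul _ _ X]a_sigma -aaM rs'.
    by rewrite tmap_tensor a1.
  exact: sr'.
(* The inverse of [alpha] in [m'] cancels the [alpha] in [Delta'] and fixes [sigma], so the given
   cocycle condition is literally the classical one. *)
have left_twistE : left_twist m' Delta' sigma =1 left_twist m Delta sigma.
  move=> x; rewrite /left_twist m'E (tmap_aut_inv_tmul bialgH).
  by rewrite (comul_aut_inv bialgH) -{1}a_sigma tmap_autK.
have cocycle' : tmap idfun (left_twist m' Delta' sigma) sigma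
    = tassoc (tmap (left_twist m' Delta' sigma) idfun sigma).
  by rewrite (eq_tmap (frefl _) left_twistE) cocycle
             (eq_tmap left_twistE (frefl _)).
have twistH := drinfeld_twist_bialgebra bialgH' (conj sr' rs') cocycle'
  counitl counitr.
apply: (yau_twist twistH) => // [x|x|x] /=.
- rewrite /twisted_comul !aaM a_sigma a_rho; congr (tmul _ (tmul _ _ _) _).
  by rewrite /= aD.
- by rewrite aut_invK.
(* Each of the two products by [m'] contributes one inverse of [alpha]: the first absorbs the
   [alpha] in [Delta'], the second the [alpha] of Yau's twist. *)
- rewrite /twisted_comul -[tmul m' sigma _]/(left_twist m' Delta' sigma _).
  rewrite left_twistE m'E (tmap_aut_inv_tmul bialgH).
  rewrite (tmap_aut_inv_tmul bialgH) (comul_aut_inv bialgH).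
  by rewrite -{2}a_sigma -{2}a_rho !tmap_autK.
Qed.
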